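(* Let $\Bbbk$ be a field and $n\ge 0$. The following is a set of defining relations for the unital associative $\Bbbk$-algebra $\widehat{\mathsf{NC}}_n$ with respect to the generators $\partial_1,\dots,\partial_{n-1},\partial_1^-,\dots,\partial_{n-1}^-$ (indices $i,j$ range over all values for which the expressions make sense): $$\partial_i^2=0,\quad \partial_i\partial_{i+1}\partial_i=\partial_{i+1}\partial_i\partial_{i+1},\quad \partial_i\partial_j=\partial_j\partial_i\ \ (|i-j|>1),$$ $$\partial_i^-\partial_i^-=0,\quad \partial_i^-\partial_{i+1}^-\partial_i^-=\partial_{i+1}^-\partial_i^-\partial_{i+1}^-,\quad \partial_i^-\partial_j^-=\partial_j^-\partial_i^-\ \ (|i-j|>1),$$ $$\partial_i\partial_j^-=\partial_j^-\partial_i\ \ (|i-j|>1),$$ $$1=\partial_i\partial_i^-+\partial_i^-\partial_i,$$ $$\partial_i\partial_{i+1}^-=(\partial_i^-+\partial_{i+1}^-)\partial_{i+1}+\partial_i^-\partial_i-1,$$ $$\partial_{i+1}\partial_i^-=\partial_i^-\partial_{i+1}+[\partial_i^-,\partial_{i+1}^-]\,[\partial_i,\partial_{i+1}]+2\,\partial_i^-\partial_{i+1}^-\partial_i^-\,\partial_i\partial_{i+1}\partial_i.$$ Here $[a,b]=ab-ba$.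
   Context: $R_n=\Bbbk[x_1,\dots,x_n]$. The symmetric group $S_n$ acts on $R_n$ by permuting the indices of the variables, and $s_i=(i,i+1)$. For $1\le i\le n-1$ the divided difference operator is $\partial_i(f)=(f-s_i f)/(x_i-x_{i+1})$, and the negative divided difference operator is $\partial_i^-:=-x_i\,\partial_i\, x_{i+1}$, i.e. $\partial_i^-(f)=-x_i\,\partial_i(x_{i+1}f)$. The double nilCoxeter algebra $\widehat{\mathsf{NC}}_n$ is the (unital) $\Bbbk$-subalgebra of $\operatorname{End}_{\Bbbk}(R_n)$ generated by $\partial_1,\dots,\partial_{n-1},\partial_1^-,\dots,\partial_{n-1}^-$. *)

(* Defs.v *)
From HB Require Import structures.
From mathcomp Require Import all_boot all_algebra all_fingroup.
(* [mpoly] comes after [monalg], whose [{mpoly R[n]}] and ['X_{1..n}] denote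
   other types. *)
From mathcomp Require Import finmap monalg mpoly.
From mathcomp Require Import boolp.

Set Implicit Arguments.
Unset Strict Implicit.
Unset Printing Implicit Defensive.

Import GRing.Theory.
Local Open Scope ring_scope.

(** * Presentations of algebras by generators and relations *)

(* The free unital associative algebra on [I]. *)
Notation "{ 'free' k [ I ] }" := {malg k[{fmonom I}]}
  (at level 0, k, I at level 2, format "{ 'free'  k [ I ] }") : type_scope.

Definition fvar (k : fieldType) (I : choiceType) (i : I) : {free k[I]} :=
  << fmu i >>.

Definition free_eval (k : fieldType) (I : choiceType) (A : algType k)
    (gen : I -> A) (p : {free k[I]}) : A :=
  monalg.mmap (in_alg A) (fun w : {fmonom I} => \prod_(i <- w) gen i) p.

(* The two-sided ideal generated by the differences [l - r], [rel l r]. *)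
Inductive ideal_gen (A : nzRingType) (rel : A -> A -> Prop) : A -> Prop :=
| IdealGen0 : ideal_gen rel 0
| IdealGenD x y : ideal_gen rel x -> ideal_gen rel y -> ideal_gen rel (x + y)
| IdealGenR a l r b : rel l r -> ideal_gen rel (a * (l - r) * b).

(* [rel l r] stands for the relation [l = r]. The canonical morphism from the
   free algebra modulo the relations to [A] is an isomorphism. *)
Definition defining_relations (k : fieldType) (I : choiceType) (A : algType k)
    (gen : I -> A) (rel : {free k[I]} -> {free k[I]} -> Prop) : Prop :=
  (forall a : A, exists p, free_eval gen p = a) /\
  (forall p, free_eval gen p = 0 <-> ideal_gen rel p).

(** * The subalgebra generated by a family *)

Section GenSubalgebra.
Variables (k : fieldType) (A : algType k) (I : Type) (gen : I -> A).

Definition gen_subalg : {pred A} := fun a =>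
  `[< forall S : {pred A},
        subalg_closed S -> (forall i, gen i \in S) -> a \in S >].

Lemma gen_subalgP a : reflect
  (forall S : {pred A}, subalg_closed S -> (forall i, gen i \in S) -> a \in S)
  (a \in gen_subalg).
Proof. exact: asboolP. Qed.

Lemma gen_subalg_closed : subalg_closed gen_subalg.
Proof.
split.
- by apply/gen_subalgP => S [].
- move=> c x y /gen_subalgP hx /gen_subalgP hy.
  apply/gen_subalgP => S cS hS; case: (cS) => _ lin _.
  by apply: lin; [apply: hx | apply: hy].
- move=> x y /gen_subalgP hx /gen_subalgP hy.
  apply/gen_subalgP => S cS hS; case: (cS) => _ _ mul.
  by apply: mul; [apply: hx | apply: hy].
Qed.

HB.instance Definition _ :=
  GRing.isSubalgClosed.Build k A gen_subalg
    (GRing.subalg_closed_semi gen_subalg_closed).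

Lemma mem_gen_subalg i : gen i \in gen_subalg.
Proof. by apply/gen_subalgP => S _; apply. Qed.

Record subalgebra := Subalgebra {
  subalgebra_val :> A;
  subalgebra_valP : subalgebra_val \in gen_subalg
}.

HB.instance Definition _ := [isSub for subalgebra_val].
HB.instance Definition _ := [Choice of subalgebra by <:].
HB.instance Definition _ := [SubChoice_isSubAlgebra of subalgebra by <:].

Definition subalgebra_gen (i : I) : subalgebra :=
  Subalgebra (mem_gen_subalg i).

End GenSubalgebra.

(** * The algebra of linear endomorphisms of [{mpoly k[n]}] *)

Section Endomorphisms.
Variables (k : fieldType) (n : nat).
Local Notation Rn := {mpoly k[n]}.

Record endo := Endo { endo_fun :> Rn -> Rn; endo_linear : linear endo_fun }.

HB.instance Definition _ (u : endo) :=
  GRing.isLinear.Build k Rn Rn *:%R (endo_fun u) (endo_linear u).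

Lemma endoP (u v : endo) : u =1 v -> u = v.
Proof.
case: u v => [f hf] [g hg] /= /funext fg; rewrite -{}fg in hg *.
by congr Endo; apply: Prop_irrelevance.
Qed.

HB.instance Definition _ := gen_eqMixin endo.
HB.instance Definition _ := gen_choiceMixin endo.

Fact endo0_linear : linear (fun _ : Rn => 0 : Rn).
Proof. by move=> c x y; rewrite scaler0 addr0. Qed.
Fact endoD_linear (u v : endo) : linear (fun x => u x + v x).
Proof. by move=> c x y; rewrite !linearP scalerDr addrACA. Qed.
Fact endoN_linear (u : endo) : linear (fun x => - u x).
Proof. by move=> c x y; rewrite linearP opprD scalerN. Qed.
Fact endoZ_linear (c : k) (u : endo) : linear (fun x => c *: u x).
Proof. by move=> d x y; rewrite linearP scalerDr !scalerA mulrC. Qed.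
Fact endo1_linear : linear (fun x : Rn => x).
Proof. by []. Qed.
Fact endoM_linear (u v : endo) : linear (fun x => u (v x)).
Proof. by move=> c x y; rewrite !linearP. Qed.

Definition endo0 := Endo endo0_linear.
Definition endoD u v := Endo (endoD_linear u v).
Definition endoN u := Endo (endoN_linear u).
Definition endoZ c u := Endo (endoZ_linear c u).
Definition endo1 := Endo endo1_linear.
Definition endoM u v := Endo (endoM_linear u v).

Fact endoDA : associative endoD.
Proof. by move=> u v w; apply: endoP => x /=; rewrite addrA. Qed.
Fact endoDC : commutative endoD.
Proof. by move=> u v; apply: endoP => x /=; rewrite addrC. Qed.
Fact endo0D : left_id endo0 endoD.
Proof. by move=> u; apply: endoP => x /=; rewrite add0r. Qed.
Fact endoND : left_inverse endo0 endoN endoD.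
Proof. by move=> u; apply: endoP => x /=; rewrite addNr. Qed.

HB.instance Definition _ :=
  GRing.isZmodule.Build endo endoDA endoDC endo0D endoND.

Fact endoMA : associative endoM.
Proof. by move=> u v w; apply: endoP. Qed.
Fact endo1M : left_id endo1 endoM.
Proof. by move=> u; apply: endoP. Qed.
Fact endoM1 : right_id endo1 endoM.
Proof. by move=> u; apply: endoP. Qed.
Fact endoMDl : left_distributive endoM +%R.
Proof. by move=> u v w; apply: endoP. Qed.
Fact endoMDr : right_distributive endoM +%R.
Proof. by move=> u v w; apply: endoP => x /=; rewrite linearD. Qed.
Fact endo1_neq0 : endo1 != 0.
Proof.
apply/eqP => /(congr1 (fun u : endo => u 1)) /= /eqP.
by rewrite oner_eq0.
Qed.

HB.instance Definition _ := GRing.Zmodule_isNzRing.Build endo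
  endoMA endo1M endoM1 endoMDl endoMDr endo1_neq0.

Fact endoZA (a b : k) (u : endo) : endoZ a (endoZ b u) = endoZ (a * b) u.
Proof. by apply: endoP => x /=; rewrite scalerA. Qed.
Fact endo1Z : left_id 1 endoZ.
Proof. by move=> u; apply: endoP => x /=; rewrite scale1r. Qed.
Fact endoZDr : right_distributive endoZ +%R.
Proof. by move=> a u v; apply: endoP => x /=; rewrite scalerDr. Qed.
Fact endoZDl (u : endo) : {morph endoZ^~ u : a b / a + b}.
Proof. by move=> a b; apply: endoP => x /=; rewrite scalerDl. Qed.

HB.instance Definition _ := GRing.Zmodule_isLmodule.Build k endo
  endoZA endo1Z endoZDr endoZDl.

Fact endoZAl (a : k) (u v : endo) : a *: (u * v) = (a *: u) * v.
Proof. exact: endoP. Qed.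
Fact endoZAr (a : k) (u v : endo) : a *: (u * v) = u * (a *: v).
Proof. by apply: endoP => x /=; rewrite linearZ. Qed.

HB.instance Definition _ := GRing.Lmodule_isLalgebra.Build k endo endoZAl.
HB.instance Definition _ := GRing.Lalgebra_isAlgebra.Build k endo endoZAr.

Lemma endoDE (u v : endo) x : (u + v) x = u x + v x. Proof. by []. Qed.
Lemma endoNE (u : endo) x : (- u) x = - u x. Proof. by []. Qed.
Lemma endoME (u v : endo) x : (u * v) x = u (v x). Proof. by []. Qed.
Lemma endoZE c (u : endo) x : (c *: u) x = c *: u x. Proof. by []. Qed.
Lemma endo0E x : (0 : endo) x = 0. Proof. by []. Qed.
Lemma endo1E x : (1 : endo) x = x. Proof. by []. Qed.

(* Multiplication by a fixed polynomial. *)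
Fact mul_endo_linear (p : Rn) : linear (fun x => p * x).
Proof. by move=> c x y; rewrite mulrDr scalerAr. Qed.

Definition mul_endo (p : Rn) : endo := Endo (mul_endo_linear p).

End Endomorphisms.

(** * Divided differences *)

Section DividedDifferences.
Variables (k : fieldType) (n : nat).
Local Notation Rn := {mpoly k[n]}.

(* Indices are shifted by one: for [i : 'I_n.-1], i.e. [i = 0, ..., n - 2], the
   variables of indices [i] and [i + 1] are ['X_(idx0 i)] and ['X_(idx1 i)]. *)
Fact idx0_subproof (i : 'I_n.-1) : (i < n)%N.
Proof. exact: leq_trans (ltn_ord i) (leq_pred n). Qed.
Fact idx1_subproof (i : 'I_n.-1) : (i.+1 < n)%N.
Proof. by rewrite -ltn_predRL. Qed.

Definition idx0 (i : 'I_n.-1) : 'I_n := Ordinal (idx0_subproof i).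
Definition idx1 (i : 'I_n.-1) : 'I_n := Ordinal (idx1_subproof i).

Lemma idx01_neq i : idx0 i != idx1 i.
Proof. by rewrite -val_eqE /= neq_ltn ltnSn. Qed.

Definition simple_refl (i : 'I_n.-1) : 'S_n := tperm (idx0 i) (idx1 i).

Lemma ddiff_exists i (f : Rn) :
  exists g : Rn,
    g * ('X_(idx0 i) - 'X_(idx1 i)) == f - msym (simple_refl i) f.
Proof.
set s := msym _; set d := 'X_(idx0 i) - _.
pose P f := exists g : Rn, g * d == f - s f.
have sM : {morph s : x y / x * y} by move=> x y; rewrite /s msymM.
have mulP f1 f2 : P f1 -> P f2 -> P (f1 * f2).
  move=> [g1 /eqP e1] [g2 /eqP e2]; exists (g1 * f2 + s f1 * g2); apply/eqP.
  rewrite mulrDl mulrAC e1 -mulrA e2 sM mulrBl mulrBr.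
  by rewrite addrA subrK.
have P1 : P 1 by exists 0; rewrite /s msym1 subrr mul0r.
have PX j : P 'X_j.
  have sX : s 'X_j = 'X_(simple_refl i j) by rewrite /s /msym mmapX mmap1U.
  rewrite /P sX /simple_refl; case: tpermP => [->|->|_ _].
  - by exists 1; rewrite mul1r.
  - by exists (-1); rewrite mulN1r opprB.
  - by exists 0; rewrite subrr mul0r.
have expP j l : P ('X_j ^+ l).
  elim: l => [|l IH]; first by rewrite expr0.
  by rewrite exprS; apply: mulP.
suff: P f by [].
elim/mpolyind: f => [|c m p _ _ [g /eqP e]].
  by exists 0; rewrite /s msym0 subrr mul0r.
have [h /eqP e'] : P 'X_[m].
  by rewrite mpolyXE_id; elim/big_rec: _ => // j x _ Px; apply: mulP.
exists (c *: h + g); rewrite mulrDl -scalerAl e e' /s msymD msymZ.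
by rewrite scalerBr opprD addrACA.
Qed.

(* The quotient [(f - s_i f) / (x_i - x_(i+1))], characterized by [ddiffE]; it
   is unique because [Rn] is a domain. *)
Definition ddiff i (f : Rn) : Rn := xchoose (ddiff_exists i f).

Lemma ddiffE i f :
  ddiff i f * ('X_(idx0 i) - 'X_(idx1 i)) = f - msym (simple_refl i) f.
Proof. exact/eqP/(xchooseP (ddiff_exists i f)). Qed.

Lemma subX_neq0 i : 'X_(idx0 i) - 'X_(idx1 i) != 0 :> Rn.
Proof.
apply/eqP => /(congr1 (fun p : Rn => p@_(U_(idx0 i))%MM)).
rewrite mcoeffB !mcoeffX eqxx mcoeff0 eq_mnm1.
by rewrite eq_sym (negbTE (idx01_neq i)) subr0 => /eqP; rewrite oner_eq0.
Qed.

Fact ddiff_linear i : linear (ddiff i).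
Proof.
move=> c f g; apply: (mulIf (subX_neq0 i)).
by rewrite mulrDl -scalerAl !ddiffE msymD msymZ scalerBr opprD addrACA.
Qed.

Definition ddiff_endo i : endo k n := Endo (ddiff_linear i).

Definition neg_ddiff_endo i : endo k n :=
  - (mul_endo 'X_(idx0 i) * ddiff_endo i * mul_endo 'X_(idx1 i)).

End DividedDifferences.

(** * The double nilCoxeter algebra *)

Section DoubleNilCoxeter.
Variables (k : fieldType) (n : nat).

(* [inl i] indexes the divided difference operators and [inr i] the negative
   ones. *)
Definition dnc_idx : choiceType := ('I_n.-1 + 'I_n.-1)%type.

Definition dnc_operator (g : dnc_idx) : endo k n :=
  match g with inl i => ddiff_endo k i | inr i => neg_ddiff_endo k i end.

Definition double_nilCoxeter : algType k := subalgebra dnc_operator.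

Definition dnc_gen (g : dnc_idx) : double_nilCoxeter :=
  subalgebra_gen dnc_operator g.

Local Notation F := {free k[dnc_idx]}.
Local Notation "'∂' i" := (fvar k (inl i : dnc_idx)) (at level 8, i at level 2).
Local Notation "'∂⁻' i" := (fvar k (inr i : dnc_idx)) (at level 8, i at level 2).
Local Notation "[ 'br' a , b ]" := (a * b - b * a) (at level 0).

Definition far (i j : 'I_n.-1) : bool := (1 < `|(i : nat) - (j : nat)|)%N.

Inductive dnc_rel : F -> F -> Prop :=
| dnc_sq i : dnc_rel (∂ i * ∂ i) 0
| dnc_braid (i j : 'I_n.-1) : j = i.+1 :> nat ->
    dnc_rel (∂ i * ∂ j * ∂ i) (∂ j * ∂ i * ∂ j)
| dnc_comm i j : far i j -> dnc_rel (∂ i * ∂ j) (∂ j * ∂ i)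
| dnc_neg_sq i : dnc_rel (∂⁻ i * ∂⁻ i) 0
| dnc_neg_braid (i j : 'I_n.-1) : j = i.+1 :> nat ->
    dnc_rel (∂⁻ i * ∂⁻ j * ∂⁻ i) (∂⁻ j * ∂⁻ i * ∂⁻ j)
| dnc_neg_comm i j : far i j -> dnc_rel (∂⁻ i * ∂⁻ j) (∂⁻ j * ∂⁻ i)
| dnc_mixed_comm i j : far i j -> dnc_rel (∂ i * ∂⁻ j) (∂⁻ j * ∂ i)
| dnc_mixed_same i : dnc_rel 1 (∂ i * ∂⁻ i + ∂⁻ i * ∂ i)
| dnc_mixed_up (i j : 'I_n.-1) : j = i.+1 :> nat ->
    dnc_rel (∂ i * ∂⁻ j) ((∂⁻ i + ∂⁻ j) * ∂ j + ∂⁻ i * ∂ i - 1)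
| dnc_mixed_down (i j : 'I_n.-1) : j = i.+1 :> nat ->
    dnc_rel (∂ j * ∂⁻ i)
      (∂⁻ i * ∂ j + [br ∂⁻ i, ∂⁻ j] * [br ∂ i, ∂ j]
       + 2 * (∂⁻ i * ∂⁻ j * ∂⁻ i * ∂ i * ∂ j * ∂ i)).

End DoubleNilCoxeter.

(* Main.v *)
Require Import Defs.
From HB Require Import structures.
From mathcomp Require Import all_boot all_algebra all_fingroup.
From mathcomp Require Import monalg mpoly.
From mathcomp Require Import boolp.
From mathcomp Require Import zify ring.

Set Implicit Arguments.
Unset Strict Implicit.
Unset Printing Implicit Defensive.

Import GRing.Theory.
Local Open Scope ring_scope.

(** In the fraction field of [R_n], both [∂_i] and [∂_i⁻] have the form
    [f |-> a f + b s_i(f)], with rational functions [a] and [b] of [x_i] and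
    [x_(i+1)].  Each relation between operators thus becomes an identity between
    rational functions in at most four variables ([loc_sq] to [loc_down]), which
    is how the relations are seen to hold.

    Conversely, let [P] be the algebra presented by the relations, [d_i] and
    [e_i] its generators corresponding to [∂_i] and [∂_i⁻].  The point is that
    [P] is simple ([double_nilCoxeter_simple]); its morphism to the nonzero
    algebra generated by the operators is then injective, and this is the
    theorem ([simple_presentation]).

    Simplicity comes from a highest weight argument.  Let [L] be the left ideal
    generated by the [d_i].  Moved to the right through a word in the [e_j], a
    [d_i] shortens this word by one letter modulo [L] ([layer_d]): the mixed
    relations have a [d] at the right of all their terms, apart from terms
    without any [d] which have also lost an [e].  So [P / L] is spanned by the
    words in the [e_j], filtered by their length.  A nilCoxeter word longer than
    the longest permutation vanishes ([word_long]).  Hence, if [T] is a word in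
    the [d_i] for the longest permutation and [W] the reversed word in the
    [e_i], then [T] maps [P] to [k + L] ([top_d_layer1]).  On the constant
    polynomial [1] the elements of [L] vanish while [T W] is the identity
    ([longest_pairing]), so that [T W] is not in [L], and a multiple [w] of [W]
    satisfies [T w = 1] modulo [L] ([top_d_section]).  It follows that
    [y = T w y] whenever all the [d_i y] are zero; as long words in the [d_i]
    vanish, a left ideal that contains [T w y] for all [w] and [y] contains
    everything ([highest_weight], [d_descent]).

    Let [K] be a proper two-sided ideal of [P].  It does not contain [T], for
    the previous remark would give [K = P].  The same argument then puts [K]
    inside [L], because an element [c + z] of [K] with [c] a nonzero scalar and
    [z] in [L] would give [c T = (c + z) T] in [K].  Now [L T = 0], since
    [d_i T = 0] for all [i], and so [K T = 0].  The [y] with [K y = 0] form a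
    left ideal containing [T P], hence containing [1], and [K = 0]. *)

(** * NilCoxeter families *)

Section NilCoxeter.
Variables (A : pzRingType) (d : nat -> A).

(** The generators are indexed by all natural numbers and are zero from [N] on,
    so that the relations carry no side conditions on indices. *)
Record nilCoxeter (N : nat) : Prop := NilCoxeter {
  nilCoxeter_out : forall i, (N <= i)%N -> d i = 0;
  nilCoxeter_sq : forall i, d i * d i = 0;
  nilCoxeter_braid : forall i, d i * d i.+1 * d i = d i.+1 * d i * d i.+1;
  nilCoxeter_comm : forall i j, (i.+1 < j)%N -> d i * d j = d j * d i }.

Definition word (w : seq nat) : A := \prod_(i <- w) d i.

Lemma word_nil : word [::] = 1. Proof. exact: big_nil. Qed.
Lemma word_cons i w : word (i :: w) = d i * word w. Proof. exact: big_cons. Qed.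
Lemma word_cat u w : word (u ++ w) = word u * word w.
Proof. exact: big_cat. Qed.
Lemma word_rcons w i : word (rcons w i) = word w * d i.
Proof. by rewrite -cats1 word_cat word_cons word_nil mulr1. Qed.

(** The [l] factors [d m * d m.-1 * ...], which stand for the minimal coset
    representatives of the permutations of [m.+1] letters by those of [m]. *)
Fixpoint down_chain (m l : nat) : A :=
  if l is l'.+1 then down_chain m l' * d (m - l') else 1.

(** A reduced word [(0 1 .. m-1)(0 1 .. m-2) .. (0)] of the longest
    permutation. *)
Fixpoint longest (m : nat) : seq nat :=
  if m is m'.+1 then iota 0 m'.+1 ++ longest m' else [::].

Lemma longestS m : longest m.+1 = iota 0 m.+1 ++ longest m. Proof. by []. Qed.

Lemma size_longest m : size (longest m) = 'C(m.+1, 2).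
Proof.
by elim: m => //= m IH; rewrite size_cat size_iota IH [in RHS]binS bin1; lia.
Qed.

Variable N : nat.
Hypothesis dN : nilCoxeter N.

Lemma down_chain_comm m l j : (j + l < m)%N ->
  down_chain m l * d j = d j * down_chain m l.
Proof.
elim: l => [|l IH] jlm /=; first by rewrite mul1r mulr1.
rewrite -mulrA -(nilCoxeter_comm dN); last by lia.
by rewrite mulrA IH ?mulrA //; lia.
Qed.

(** The braid relation moves a letter inside the range of the chain to the left,
    lowering its index by one. *)
Lemma down_chain_shift m l j : (l <= m)%N -> (m <= j + l)%N -> (j < m)%N ->
  down_chain m l.+1 * d j.+1 = d j * down_chain m l.+1.
Proof.
elim: l => [|l IH] lm mjl jm; first lia.
have [mjl'|mjl'] := leqP m (j + l).
  rewrite [down_chain _ _]/= -/(down_chain m l.+1).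
  rewrite -[in LHS]mulrA (nilCoxeter_comm dN); last by lia.
  by rewrite mulrA IH ?mulrA //; lia.
have -> : j = (m - l.+1)%N by lia.
rewrite /=; have -> : (m - l = (m - l.+1).+1)%N by lia.
rewrite -!mulrA [X in _ * X]mulrA -(nilCoxeter_braid dN) !mulrA.
by rewrite down_chain_comm //; lia.
Qed.

Lemma down_chain_sq m l : down_chain m l.+1 * d (m - l) = 0.
Proof. by rewrite /= -mulrA (nilCoxeter_sq dN) mulr0. Qed.

(** Normal forms: the permutations of [m.+1] letters factor through those of [m]
    letters, and the relations realize this factorization on words without
    changing their length. *)
Lemma word_normal m w : all (fun i => i < m.+1)%N w ->
  word w = 0 \/ exists u l, [/\ all (fun i => i < m)%N u, (l <= m.+1)%N,
    (size u + l)%N = size w & word w = word u * down_chain m l].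
Proof.
elim/last_ind: w => [_|w j IH].
  by right; exists [::], 0%N; rewrite /= mulr1.
rewrite all_rcons => /andP[jm /IH [w0|[u [l [um lm sz eqw]]]]].
  by left; rewrite word_rcons w0 mul0r.
rewrite word_rcons eqw size_rcons -sz -mulrA.
have extend : all (fun i => i < m)%N (rcons u j) = (j < m)%N.
  by rewrite all_rcons um andbT.
case: l lm sz eqw => [|l] lm sz eqw.
  right; have [jlt|jge] := ltnP j m.
    exists (rcons u j), 0%N; split; rewrite ?extend ?size_rcons //.
    by rewrite word_rcons /= mul1r mulr1.
  exists u, 1%N; split=> //; try lia.
  by rewrite /= subn0 (_ : j = m) //; lia.
have [jlm|] := ltnP (j + l.+1) m.
  right; exists (rcons u j), l.+1.
  split; rewrite ?extend ?size_rcons //; try lia.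
  by rewrite word_rcons down_chain_comm // mulrA.
rewrite leq_eqVlt => /orP[/eqP jlm|].
  right; exists u, l.+2; split => //; try lia.
  by rewrite [in RHS]/= (_ : m - l.+1 = j)%N //; lia.
rewrite addnS ltnS leq_eqVlt => /orP[/eqP jlm|jlm].
  by left; rewrite (_ : j = m - l)%N ?down_chain_sq ?mulr0 //; lia.
case: j jm extend jlm => [|j] jm extend jlm; first lia.
right; exists (rcons u j), l.+1.
split; rewrite ?all_rcons ?um ?size_rcons //; try lia.
by rewrite word_rcons down_chain_shift ?mulrA //; lia.
Qed.

(** Each normal form uses at most [m] letters of its [m]-th chain, which bounds
    its length by that of the longest permutation. *)
Lemma word_long w : ('C(N.+1, 2) < size w)%N -> word w = 0.
Proof.
move=> szw; have [wN|] := boolP (all (fun i => i < N)%N w); last first.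
  rewrite -has_predC => /hasP [i iw]; rewrite /= -leqNgt => Ni.
  case/splitPr: iw => p q.
  by rewrite word_cat word_cons (nilCoxeter_out dN Ni) mul0r mulr0.
move: szw wN; elim: N w => [|m IH] w szw wm.
  by case: w szw wm.
case: (word_normal wm) => // -[u [l [um lm sz ->]]].
rewrite IH ?mul0r //; move: szw.
by rewrite -sz (binS m.+1 1) bin1; lia.
Qed.

Lemma word_up m : word (iota 0 m.+1) = word (iota 0 m) * d m.
Proof. by rewrite -addn1 iotaD add0n word_cat word_cons word_nil mulr1. Qed.

Lemma up_word_comm m i : (m < i)%N ->
  d i * word (iota 0 m) = word (iota 0 m) * d i.
Proof.
elim: m => [|m IH] mi; first by rewrite word_nil mulr1 mul1r.
by rewrite word_up mulrA IH -?mulrA ?(nilCoxeter_comm dN (i := m)) //; lia.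
Qed.

Lemma up_word_shift m i : (i.+1 < m)%N ->
  d i.+1 * word (iota 0 m) = word (iota 0 m) * d i.
Proof.
elim: m => // m IH; rewrite ltnS leq_eqVlt => /orP[/eqP <-|im].
  rewrite !word_up !mulrA up_word_comm; last by lia.
  by rewrite -!mulrA [X in _ * X]mulrA -(nilCoxeter_braid dN) !mulrA.
by rewrite word_up mulrA IH // -!mulrA (nilCoxeter_comm dN).
Qed.

(** The longest permutation has every left descent. *)
Lemma longest_killed m i : (i < m)%N -> d i * word (longest m) = 0.
Proof.
elim: m i => // m IH [|i] im; rewrite longestS word_cat.
  by rewrite word_cons !mulrA (nilCoxeter_sq dN) !mul0r.
by rewrite mulrA up_word_shift // -mulrA IH ?mulr0.
Qed.

Lemma word_longest_killed i : d i * word (longest N) = 0.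
Proof.
by have [/longest_killed //|/(nilCoxeter_out dN) ->] := ltnP i N; rewrite mul0r.
Qed.

End NilCoxeter.

(** * Simplicity of the double nilCoxeter algebra *)

Section DoubleNilCoxeterRing.
Variables (k : fieldType) (A : pzRingType) (scal : {rmorphism k -> A}).
Variables (N : nat) (d e : nat -> A).
Local Notation "c %:K" := (scal c) (at level 2, format "c %:K").

Record double_nilCoxeter_relations : Prop := DoubleNilCoxeterRelations {
  rel_d : nilCoxeter d N;
  rel_e : nilCoxeter e N;
  rel_far : forall i j, ((i.+1 < j) || (j.+1 < i))%N -> d i * e j = e j * d i;
  rel_same : forall i, (i < N)%N -> 1 = d i * e i + e i * d i;
  rel_up : forall i, (i.+1 < N)%N ->
    d i * e i.+1 = (e i + e i.+1) * d i.+1 + e i * d i - 1;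
  rel_down : forall i, (i.+1 < N)%N ->
    d i.+1 * e i = e i * d i.+1
      + (e i * e i.+1 - e i.+1 * e i) * (d i * d i.+1 - d i.+1 * d i)
      + 2 * (e i * e i.+1 * e i * d i * d i.+1 * d i) }.

Hypothesis rels : double_nilCoxeter_relations.
Hypothesis central : forall c x, c%:K * x = x * c%:K.
(* As scalars commute with everything, this says that [A] is generated by the
   scalars, the [d i] and the [e i]. *)
Hypothesis generated : forall S : A -> Prop,
  (forall c, S c%:K) -> (forall x y, S x -> S y -> S (x + y)) ->
  (forall i x, S x -> S (d i * x)) -> (forall i x, S x -> S (e i * x)) ->
  forall x, S x.

Local Notation dP := (rel_d rels).
Local Notation eP := (rel_e rels).

Inductive left_ideal : A -> Prop :=
| LeftGen a i : left_ideal (a * d i)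
| LeftD x y : left_ideal x -> left_ideal y -> left_ideal (x + y).

Lemma left_ideal_mull a x : left_ideal x -> left_ideal (a * x).
Proof.
elim=> [b i|y z _ IHy _ IHz]; first by rewrite mulrA; apply: LeftGen.
by rewrite mulrDr; apply: LeftD.
Qed.

(** [layer l.+1] consists of the combinations of words of length [l] in the [e i]
    modulo [left_ideal], and [layer 0] is [left_ideal]; the shift by one lets
    [d i] lower the layer by one in all cases. *)
Inductive layer : nat -> A -> Prop :=
| LayerLeft l x : left_ideal x -> layer l x
| LayerScalar c : layer 1 c%:K
| LayerE l i x : layer l x -> layer l.+1 (e i * x)
| LayerD l x y : layer l x -> layer l y -> layer l (x + y).

Lemma layer_left_ideal x : layer 0 x -> left_ideal x.
Proof.
suff H l : layer l x -> l = 0%N -> left_ideal x by move/H; apply.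
by elim=> // {l x} l x y _ IHx _ IHy l0; apply: LeftD; auto.
Qed.

Lemma layer0 l : layer l 0.
Proof. by rewrite -(mul0r (d 0)); apply/LayerLeft/LeftGen. Qed.

Lemma layerN l x : layer l x -> layer l (- x).
Proof.
elim=> {l x} [l x Lx|c|l i x _ IH|l x y _ IHx _ IHy].
- by rewrite -mulN1r; apply/LayerLeft/left_ideal_mull.
- by rewrite -rmorphN; apply: LayerScalar.
- by rewrite -mulrN; apply: LayerE.
- by rewrite opprD; apply: LayerD.
Qed.

Lemma layerB l x y : layer l x -> layer l y -> layer l (x - y).
Proof. by move=> lx ly; apply: LayerD => //; apply: layerN. Qed.

Lemma layer_e l i x : layer l.-1 x -> layer l (e i * x).
Proof.
case: l => [|l] /=; last exact: LayerE.
by move=> /layer_left_ideal Lx; apply/LayerLeft/left_ideal_mull.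
Qed.

(** Moving [d i] to the right past the first letter [e j] of a word leaves it in
    front of a shorter word, to which induction applies.  In the relation for
    [i = j.+1], two or three letters [d] act in turn on that shorter word, so the
    induction has to cover all lower layers. *)
Lemma layer_d l i x : layer l x -> layer l.-1 (d i * x).
Proof.
have [m] := ubnP l; elim: m l i x => // m IH l i x + lx.
elim: lx i => {l x} [l x Lx|c|l j x lx _|l x y _ IHx _ IHy] i lm.
- by apply/LayerLeft/left_ideal_mull.
- by rewrite -central; apply/LayerLeft/LeftGen.
- have {IH}IHd l' u y : (l' <= l)%N -> layer l' y -> layer l'.-1 (d u * y).
    by move=> l'l; apply: IH; apply: leq_ltn_trans l'l _.
  have [Ni|iN] := leqP N i.
    by rewrite (nilCoxeter_out dP Ni) mul0r; apply: layer0.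
  have [Nj|jN] := leqP N j.
    by rewrite (nilCoxeter_out eP Nj) mul0r mulr0; apply: layer0.
  have IHe u v : layer l (e u * (d v * x)).
    by apply/layer_e/IHd.
  rewrite /=; case: (ltngtP i j) => [lt_ij|lt_ji|eq_ij]; last 1 first.
  + rewrite -{j jN}eq_ij mulrA.
    have -> : d i * e i = 1 - e i * d i.
      by rewrite [X in X - _](rel_same rels iN) addrK.
    by rewrite mulrBl mul1r -mulrA; apply: layerB.
  + move: lt_ij; rewrite leq_eqVlt => /orP[/eqP ij|far]; last first.
      by rewrite mulrA (rel_far rels) ?far // -mulrA.
    rewrite -{j}ij in jN IHe *.
    rewrite mulrA (rel_up rels) // mulrBl mul1r !mulrDl -!mulrA.
    by apply: layerB => //; do !apply: LayerD.
  move: lt_ji; rewrite leq_eqVlt => /orP[/eqP ij|far]; last first.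
    by rewrite mulrA (rel_far rels) ?far ?orbT // -mulrA.
  rewrite -{i}ij in iN IHe *.
  (* Each [d] lowers the layer by one and each [e] raises it back. *)
  have layer_ee u v u' v' : layer l (e u * (e v * (d u' * (d v' * x)))).
    by do 2!apply: layer_e; apply: (IHd); [exact: leq_pred | exact: (IHd)].
  have layer_eee u v w y :
    layer l.-1.-1.-1 y -> layer l (e u * (e v * (e w * y))).
    by move=> ly; do 3!apply: layer_e.
  rewrite mulrA (rel_down rels) // mulr_natl mulr2n !mulrDl -!mulrA.
  rewrite !mulrBl !mulrBr !mulNr -!mulrA.
  apply: LayerD; last first.
    have ly: layer l.-1.-1.-1 (d j * (d j.+1 * (d j * x))).
      by apply: (IHd); [lia|apply: (IHd); [lia|exact: (IHd)]].
    by apply: LayerD; apply: layer_eee.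
  by apply: LayerD => //; apply: LayerD; apply: layerB => //; apply: layerN.
- by rewrite mulrDr; apply: LayerD; auto.
Qed.

Lemma layer_word_d w l x : layer l x -> layer (l - size w) (word d w * x).
Proof.
move=> lx; elim: w => [|i w IH]; first by rewrite word_nil mul1r subn0.
by rewrite word_cons -mulrA /= subnS; apply: layer_d.
Qed.

Lemma layer_word_e w l x :
  layer l x -> ('C(N.+1, 2).+1 < size w + l)%N -> left_ideal (word e w * x).
Proof.
move=> lx; elim: lx w => {l x} [l x Lx|c|l i x _ IH|l x y _ IHx _ IHy] w szw.
- exact: left_ideal_mull.
- rewrite (word_long eP); last by lia.
  by apply: layer_left_ideal; rewrite mul0r; apply: layer0.
- by rewrite mulrA -word_rcons; apply: IH; rewrite size_rcons addSnnS.
- by rewrite mulrDr; apply: LeftD; auto.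
Qed.

Local Notation top_d := (word d (longest N)).
Local Notation top_e := (word e (rev (longest N))).

(** [top_d] has as many letters as the longest nonzero words in the [e i]: it
    sends these words to the scalars and the shorter ones to [left_ideal]. *)
Lemma layer_top_d l x : layer l x -> layer 1 (top_d * x).
Proof.
move=> lx; have [l_big|l_small] := ltnP 'C(N.+1, 2).+1 l.
  apply/LayerLeft/left_ideal_mull.
  by rewrite -[x]mul1r -(word_nil e); apply: layer_word_e lx _.
have := layer_word_d (longest N) lx; rewrite size_longest.
case: (_ - _)%N (leq_sub2r 'C(N.+1, 2) l_small) => [_ /layer_left_ideal|[]] //.
  exact: LayerLeft.
by move=> m; rewrite subSnn.
Qed.

Inductive layer_sum : A -> Prop :=
| LayerSumV l x : layer l x -> layer_sum x
| LayerSumD x y : layer_sum x -> layer_sum y -> layer_sum (x + y).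

Lemma layer_sumP x : layer_sum x.
Proof.
elim/generated: x => [c|x y|i x|i x]; first exact/LayerSumV/LayerScalar.
- exact: LayerSumD.
- elim=> {x} [l x lx|x y _ IHx _ IHy]; first exact/LayerSumV/layer_d/lx.
  by rewrite mulrDr; apply: LayerSumD.
- elim=> {x} [l x lx|x y _ IHx _ IHy]; first exact/LayerSumV/LayerE/lx.
  by rewrite mulrDr; apply: LayerSumD.
Qed.

Lemma top_d_layer1 x : layer 1 (top_d * x).
Proof.
elim: (layer_sumP x) => {x} [l x|x y _ IHx _ IHy]; first exact: layer_top_d.
by rewrite mulrDr; apply: LayerD.
Qed.

Lemma layer1P x : layer 1 x -> exists c y, left_ideal y /\ x = c%:K + y.
Proof.
suff H l : layer l x -> l = 1%N -> exists c y, left_ideal y /\ x = c%:K + y.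
  by move/H; apply.
elim=> {l x} [l x Lx|c|l i x lx _|l x y _ IHx _ IHy] l1.
- by exists 0, x; rewrite rmorph0 add0r.
- exists c, 0; rewrite addr0; split=> //.
  by apply: layer_left_ideal; apply: layer0.
- case: l1 lx => -> /layer_left_ideal Lx.
  exists 0, (e i * x); rewrite rmorph0 add0r.
  by split=> //; apply: left_ideal_mull.
- have [[c [x' [Lx ->]]] [c' [y' [Ly ->]]]] := (IHx l1, IHy l1).
  exists (c + c'), (x' + y'); rewrite rmorphD addrACA.
  by split=> //; apply: LeftD.
Qed.

(** Long words in the [d i] vanish, so a property holds as soon as it passes from
    all the [d i * x] to [x].  The set [K] restricts the claim to elements which
    are known to stay in [K]. *)
Lemma d_descent (J K : A -> Prop) :
    J 0 -> (forall i x, K x -> K (d i * x)) ->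
    (forall x, K x -> (forall i, J (d i * x)) -> J x) ->
  forall x, K x -> J x.
Proof.
move=> J0 Kd JK x Kx; rewrite -[x]mul1r -(word_nil d).
have Kw w : K (word d w * x).
  elim: w => [|i w IH]; first by rewrite word_nil mul1r.
  by rewrite word_cons -mulrA; apply: Kd.
move: [::] => w; move: {2}(_ - _)%N (leqnn ('C(N.+1, 2).+1 - size w)) => m.
elim: m w => [|m IH] w szw.
  by rewrite (word_long dP) ?mul0r //; lia.
apply: JK => // i; rewrite mulrA -word_cons; apply: IH; rewrite /=; lia.
Qed.

Hypothesis top_nondegenerate : ~ left_ideal (top_d * top_e).

Lemma top_d_section : exists w z, left_ideal z /\ top_d * w = 1 + z.
Proof.
have [c [z [Lz eqz]]] := layer1P (top_d_layer1 top_e).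
have c_neq0 : c != 0.
  apply/eqP => c0; apply: top_nondegenerate.
  by rewrite eqz c0 rmorph0 add0r.
exists (c^-1%:K * top_e), (c^-1%:K * z); split; first exact: left_ideal_mull.
by rewrite mulrA -central -mulrA eqz mulrDr -rmorphM mulVf // rmorph1.
Qed.

Definition left_closed (J : A -> Prop) :=
  [/\ J 0, forall x y, J x -> J y -> J (x + y) & forall a x, J x -> J (a * x)].

Lemma left_ideal_closed : left_closed left_ideal.
Proof.
split; [|exact: LeftD|exact: left_ideal_mull].
by rewrite -(mul0r (d 0)); apply: LeftGen.
Qed.

(** If all the [d i * y] vanish modulo [J], then so does [left_ideal] applied to
    [y], and the element [w] of [top_d_section] gives [y = top_d * (w * y)]
    modulo [J]. *)
Lemma highest_weight (J : A -> Prop) y : left_closed J ->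
  (forall w, J (top_d * (w * y))) -> (forall i, J (d i * y)) -> J y.
Proof.
case=> J0 JD JM Jtop Jdy; have [w [z [Lz eqz]]] := top_d_section.
have Jzy : J (z * y).
  elim: Lz {eqz} => {z} [a i|u v _ IHu _ IHv].
    by rewrite -mulrA; apply: JM.
  by rewrite mulrDl; apply: JD.
have -> : y = top_d * (w * y) + -1 * (z * y).
  by rewrite mulrA eqz mulrDl mul1r mulN1r addrK.
by apply: JD => //; apply: JM.
Qed.

Definition two_sided (K : A -> Prop) :=
  left_closed K /\ forall a x, K x -> K (x * a).

Lemma left_ideal_top x : left_ideal x -> x * top_d = 0.
Proof.
elim=> {x} [a i|x y _ IHx _ IHy].
  by rewrite -mulrA (word_longest_killed dP) mulr0.
by rewrite mulrDl IHx IHy addr0.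
Qed.

(** First [top_d] is not in [K], then [K] lies in [left_ideal], whence
    [K * top_d = 0]; the right annihilator of [K] is everything. *)
Theorem double_nilCoxeter_simple (K : A -> Prop) :
  two_sided K -> ~ K 1 -> forall x, K x -> x = 0.
Proof.
case=> Kl KMr K1; have [K0 KD KMl] := Kl.
have not_top : ~ K top_d.
  move=> Ktop; apply/K1/(d_descent (K := fun=> True)) => // y _.
  by apply: highest_weight => // w; apply: KMr.
have K_left x : K x -> left_ideal x.
  have [L0 LD _] := left_ideal_closed.
  apply: d_descent => // [i y|y Ky]; first exact: KMl.
  apply: highest_weight left_ideal_closed _ => w.
  have [c [z [Lz eqz]]] := layer1P (top_d_layer1 (w * y)).
  have Kcz : K (c%:K + z) by rewrite -eqz; do 2!apply: (KMl).
  have [c0|c_neq0] := eqVneq c 0; first by rewrite eqz c0 rmorph0 add0r.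
  case: not_top; rewrite -[top_d]mul1r -(rmorph1 scal) -(mulVf c_neq0).
  rewrite rmorphM -mulrA.
  apply: KMl; rewrite -[X in K X]addr0 -(left_ideal_top Lz) -mulrDl.
  exact: KMr.
suff ann y : forall x, K x -> x * y = 0 by move=> x Kx; rewrite -[x]mulr1 ann.
pose J y := forall x, K x -> x * y = 0.
have Jl : left_closed J.
  split=> [x _|u v Ju Jv x Kx|a u Ju x Kx]; first by rewrite mulr0.
    by rewrite mulrDr Ju // Jv // addr0.
  by rewrite mulrA Ju //; apply: KMr.
apply: (d_descent (K := fun=> True) (J := J)) => // [|{}y _].
  by case: Jl.
apply: highest_weight => // w x /K_left Lx.
by rewrite mulrA left_ideal_top // mul0r.
Qed.

End DoubleNilCoxeterRing.

(** * Rings presented by generators and relations *)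

Section PresentedRing.
Variables (A : nzRingType) (rel : A -> A -> Prop).

Lemma ideal_gen_mull a x : ideal_gen rel x -> ideal_gen rel (a * x).
Proof.
elim=> [|y z _ IHy _ IHz|b l r c lr].
- by rewrite mulr0; apply: IdealGen0.
- by rewrite mulrDr; apply: IdealGenD.
- by rewrite !mulrA; apply: IdealGenR.
Qed.

Lemma ideal_gen_mulr a x : ideal_gen rel x -> ideal_gen rel (x * a).
Proof.
elim=> [|y z _ IHy _ IHz|b l r c lr].
- by rewrite mul0r; apply: IdealGen0.
- by rewrite mulrDl; apply: IdealGenD.
- by rewrite -mulrA; apply: IdealGenR.
Qed.

Definition ideal_pred : {pred A} := fun x => `[< ideal_gen rel x >].

Lemma ideal_predP x : reflect (ideal_gen rel x) (x \in ideal_pred).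
Proof. exact: asboolP. Qed.

Fact ideal_pred_zmod_closed : zmod_closed ideal_pred.
Proof.
split=> [|x y /ideal_predP Ix /ideal_predP Iy]; apply/ideal_predP.
  exact: IdealGen0.
by apply: IdealGenD => //; rewrite -mulN1r; apply: ideal_gen_mull.
Qed.

HB.instance Definition _ :=
  GRing.isZmodClosed.Build A ideal_pred ideal_pred_zmod_closed.

(** The additive quotient; its product is built below from representatives, the
    ideal being two-sided. *)
Definition presented := Quotient.quot ideal_pred.
HB.instance Definition _ := GRing.Zmodule.on presented.

Definition pres (x : A) : presented := \pi_presented%qT x.

Lemma pres_eq x y : pres x = pres y <-> ideal_gen rel (x - y).
Proof.
split=> [xy|/ideal_predP]; last by rewrite Quotient.idealrBE => /eqP.
by apply/ideal_predP; rewrite Quotient.idealrBE; apply/eqP.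
Qed.

Definition pres_repr (x : presented) : A := generic_quotient.repr x.

Lemma presK x : pres (pres_repr x) = x.
Proof. exact: generic_quotient.reprK. Qed.

Lemma presD : {morph pres : x y / x + y}.
Proof. exact: Quotient.pi_add. Qed.

Lemma presN : {morph pres : x / - x}.
Proof. exact: Quotient.pi_opp. Qed.

Definition presented_mul (x y : presented) := pres (pres_repr x * pres_repr y).

Lemma presM x y : pres (x * y) = presented_mul (pres x) (pres y).
Proof.
have /pres_eq xx := presK (pres x); have /pres_eq yy := presK (pres y).
apply/esym/pres_eq.
rewrite -[_ * _](subrK (x * pres_repr (pres y))) -mulrBl -addrA -mulrBr.
by apply: IdealGenD; [apply: ideal_gen_mulr | apply: ideal_gen_mull].
Qed.

Fact presented_mulA : associative presented_mul.
Proof.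
by move=> x y z; rewrite -[x]presK -[y]presK -[z]presK -!presM mulrA.
Qed.
Fact presented_mul1 : left_id (pres 1) presented_mul.
Proof. by move=> x; rewrite -[x]presK -presM mul1r. Qed.
Fact presented_mulr1 : right_id (pres 1) presented_mul.
Proof. by move=> x; rewrite -[x]presK -presM mulr1. Qed.
Fact presented_mulDl : left_distributive presented_mul +%R.
Proof.
move=> x y z; rewrite -[x]presK -[y]presK -[z]presK.
by rewrite -presD -!presM mulrDl presD.
Qed.
Fact presented_mulDr : right_distributive presented_mul +%R.
Proof.
move=> x y z; rewrite -[x]presK -[y]presK -[z]presK.
by rewrite -presD -!presM mulrDr presD.
Qed.

HB.instance Definition _ := GRing.Zmodule_isPzRing.Build presented
  presented_mulA presented_mul1 presented_mulr1 presented_mulDl presented_mulDr.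

Fact pres_is_additive : zmod_morphism pres.
Proof. by move=> x y; rewrite presD presN. Qed.
Fact pres_is_multiplicative : monoid_morphism pres.
Proof. by split=> // x y; apply: presM. Qed.

HB.instance Definition _ :=
  GRing.isZmodMorphism.Build A presented pres pres_is_additive.
HB.instance Definition _ :=
  GRing.isMonoidMorphism.Build A presented pres pres_is_multiplicative.

Lemma pres_rel l r : rel l r -> pres l = pres r.
Proof.
move=> lr; apply/pres_eq; rewrite -[_ - _]mul1r -[_ * _]mulr1.
exact: IdealGenR.
Qed.

Lemma pres_eq0 x : pres x = 0 <-> ideal_gen rel x.
Proof. by rewrite -(rmorph0 pres) pres_eq subr0. Qed.

End PresentedRing.

Section FreeAlgebra.
Variables (k : fieldType) (I : choiceType).
Local Notation F := {free k[I]}.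

Lemma free_ind (S : F -> Prop) :
  (forall c, S c%:A) -> (forall x y, S x -> S y -> S (x + y)) ->
  (forall i x, S x -> S (fvar k i * x)) -> forall x, S x.
Proof.
move=> S1 SD SM x; rewrite (monalgE x).
apply: (big_ind S) => [|//|w _]; first by rewrite -(scale0r 1); apply: S1.
move: (monalg.mcoeff w x) => c; case: w => w; elim: w => [|i w IH].
  have -> : << c *g FMonom [::] >> = c%:A :> F.
    by rewrite -mul_malgC mulr1 -fmoneE.
  exact: S1.
have -> : << c *g FMonom (i :: w) >> = fvar k i * << c *g FMonom w >>.
  rewrite /fvar malgM_def fgmulUU mul1r; congr << _ *g _ >>.
  by apply/eqP; rewrite fmP fmM fmU.
exact: SM.
Qed.

Lemma free_scalar_central (c : k) (p : F) : c%:A * p = p * c%:A.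
Proof.
rewrite -mul_malgC mulr1 [p]monalgE mulr_sumr mulr_suml; apply: eq_bigr => w _.
by rewrite !malgM_def !fgmulUU mul1m mulm1 mulrC.
Qed.

Section Eval.
Variables (A : algType k) (gen : I -> A).

Definition word_eval (w : {fmonom I}) : A := \prod_(i <- w) gen i.

Fact word_eval_mmorphism : mmorphism word_eval.
Proof.
split=> [v w|]; rewrite /word_eval; first by rewrite fmM big_cat.
by rewrite fm1 big_nil.
Qed.
HB.instance Definition _ :=
  monalg.isMultiplicative.Build _ _ word_eval word_eval_mmorphism.

Fact free_eval_is_additive : zmod_morphism (free_eval gen).
Proof. exact: (monalg.mmap_is_additive (h := word_eval)). Qed.
Fact free_eval_is_multiplicative : monoid_morphism (free_eval gen).
Proof.
have [M1 M2] : multiplicative (monalg.mmap (in_alg A) word_eval).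
  apply: monalg.commr_mmap_is_multiplicative => g m m'.
  by rewrite /GRing.comm mulr_algl mulr_algr.
by split.
Qed.
HB.instance Definition _ :=
  GRing.isZmodMorphism.Build F A (free_eval gen) free_eval_is_additive.
HB.instance Definition _ :=
  GRing.isMonoidMorphism.Build F A (free_eval gen) free_eval_is_multiplicative.

Lemma free_evalZ c p : free_eval gen (c *: p) = c *: free_eval gen p.
Proof.
by rewrite -[RHS]mulr_algl; apply: (monalg.mmapZ (h := word_eval)).
Qed.

Lemma free_eval_fvar i : free_eval gen (fvar k i) = gen i.
Proof.
rewrite /free_eval /fvar monalg.mmapU /= scale1r mul1r.
by rewrite fmU big_seq1.
Qed.

End Eval.

Lemma gen_subalg_eval (A : algType k) (gen : I -> A) a :
  a \in gen_subalg gen -> exists p, free_eval gen p = a.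
Proof.
pose S : {pred A} := fun a => `[< exists p, free_eval gen p = a >].
move/gen_subalgP => /(_ S) aS; apply/asboolP/aS => [|i]; last first.
  by apply/asboolP; exists (fvar k i); apply: free_eval_fvar.
split.
- by apply/asboolP; exists 1; rewrite rmorph1.
- move=> c x y /asboolP[p <-] /asboolP[q <-]; apply/asboolP.
  by exists (c *: p + q); rewrite rmorphD /= free_evalZ.
- move=> x y /asboolP[p <-] /asboolP[q <-]; apply/asboolP.
  by exists (p * q); rewrite rmorphM.
Qed.

Lemma subalgebra_eval (A : algType k) (gen : I -> A) p :
  subalgebra_val (free_eval (subalgebra_gen gen) p) = free_eval gen p.
Proof.
elim/free_ind: p => [c|x y IHx IHy|i x IHx].
- have evA (B : algType k) (g : I -> B) : free_eval g c%:A = c%:A.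
    by rewrite free_evalZ rmorph1.
  by rewrite !evA.
- by rewrite !rmorphD /= IHx IHy.
- by rewrite !rmorphM /= IHx !free_eval_fvar.
Qed.

End FreeAlgebra.

(** * Skew operators on a field *)

Section SkewOperators.
Variables (F : fieldType) (B : nzRingType) (G : Type) (loc : B -> G -> F).

(** The form taken by the action on a fixed polynomial [f]: [u] ranges over
    operators, [g] over permutations, and [loc u g] stands for [g (u f)] in the
    fraction field, where [x g] and [y g] are the images under [g] of the two
    variables exchanged by the reflection [s].  An identity between operators is
    then one between rational functions of the values [loc 1 g]. *)
Definition acts_by_swap (s : G -> G) (x y : G -> F) (d e : B) : Prop :=
  (forall u g, loc (d * u) g = (loc u g - loc u (s g)) / (x g - y g)) /\
  (forall u g, loc (e * u) g =
     - (x g * ((y g * loc u g - x g * loc u (s g)) / (x g - y g)))).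

Hypothesis locD : forall u v g, loc (u + v) g = loc u g + loc v g.
Hypothesis locN : forall u g, loc (- u) g = - loc u g.

Section OneReflection.
Variables (s : G -> G) (x y : G -> F) (d e : B).
Hypothesis de : acts_by_swap s x y d e.
Hypothesis ss : forall g, s (s g) = g.
Hypothesis xs : forall g, x (s g) = y g.
Hypothesis ys : forall g, y (s g) = x g.
Hypothesis xy : forall g, x g - y g != 0.

Let locE := (locD, locN, de.1, de.2, ss, xs, ys).

Fact yx g : y g - x g != 0.
Proof. by have := xy (s g); rewrite xs ys. Qed.

(* The hypotheses describe products [d * u]: in the proofs below, a final factor
   [1] brings all words to this form. *)
Lemma loc_sq g : loc (d * d) g = 0.
Proof. by rewrite -[d * d]mulr1 -mulrA !locE; field; rewrite xy yx. Qed.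

Lemma loc_neg_sq g : loc (e * e) g = 0.
Proof. by rewrite -[e * e]mulr1 -mulrA !locE; field; rewrite xy yx. Qed.

Lemma loc_same g : loc (d * e + e * d) g = loc 1 g.
Proof.
rewrite -[d * e + e * d]mulr1 mulrDl -!mulrA !locE.
by field; rewrite xy yx.
Qed.

End OneReflection.

(** Operators of the form [f |-> a f + b s(f)] commute when their reflections do
    and each reflection fixes the coefficients of the other operator. *)
Lemma loc_far (s t : G -> G) (a b : B) (a0 a1 b0 b1 : G -> F) g :
  (forall u g, loc (a * u) g = a0 g * loc u g + a1 g * loc u (s g)) ->
  (forall u g, loc (b * u) g = b0 g * loc u g + b1 g * loc u (t g)) ->
  (forall g, s (t g) = t (s g)) ->
  (forall g, a0 (t g) = a0 g) -> (forall g, a1 (t g) = a1 g) ->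
  (forall g, b0 (s g) = b0 g) -> (forall g, b1 (s g) = b1 g) ->
  loc (a * b) g = loc (b * a) g.
Proof.
move=> la lb st a0t a1t b0s b1s; rewrite -[a * b]mulr1 -[b * a]mulr1 -!mulrA.
rewrite !(la, lb) !(a0t, a1t, b0s, b1s) st; ring.
Qed.

(* Adjacent reflections: [x], [y], [z] are the images of three consecutive
   variables, and the orbit of [g] has the six elements of the symmetric group on
   three letters. *)
Section TwoReflections.
Variables (s t : G -> G) (x y z : G -> F) (d e d' e' : B).
Hypothesis de : acts_by_swap s x y d e.
Hypothesis de' : acts_by_swap t y z d' e'.
Hypothesis ss : forall g, s (s g) = g.
Hypothesis tt : forall g, t (t g) = g.
Hypothesis tst : forall g, t (s (t g)) = s (t (s g)).
Hypothesis xs : forall g, x (s g) = y g.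
Hypothesis ys : forall g, y (s g) = x g.
Hypothesis zs : forall g, z (s g) = z g.
Hypothesis xt : forall g, x (t g) = x g.
Hypothesis yt : forall g, y (t g) = z g.
Hypothesis zt : forall g, z (t g) = y g.
Hypothesis xy : forall g, x g - y g != 0.

Let locE := (locD, locN, de.1, de.2, de'.1, de'.2,
  xs, ys, zs, xt, yt, zt, ss, tt, tst).

Fact distinct g : (x g - y g != 0) * (y g - x g != 0) * (x g - z g != 0)
  * (z g - x g != 0) * (y g - z g != 0) * (z g - y g != 0).
Proof.
have h1 := xy g; have h2 := xy (t g); have h3 := xy (t (s g)).
have opp (a b : F) : a - b != 0 -> b - a != 0 by rewrite -opprB oppr_eq0.
move: h1 h2 h3; rewrite !locE => h1 h2 h3.
by rewrite h1 h2 h3 (opp _ _ h1) (opp _ _ h2) (opp _ _ h3).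
Qed.

Lemma loc_braid g : loc (d * d' * d) g = loc (d' * d * d') g.
Proof.
rewrite -[d * _ * d]mulr1 -[d' * _ * d']mulr1 -!mulrA !locE.
by field; rewrite !distinct.
Qed.

Lemma loc_neg_braid g : loc (e * e' * e) g = loc (e' * e * e') g.
Proof.
rewrite -[e * _ * e]mulr1 -[e' * _ * e']mulr1 -!mulrA !locE.
by field; rewrite !distinct.
Qed.

Lemma loc_up g : loc (d * e') g = loc ((e + e') * d' + e * d - 1) g.
Proof.
rewrite -[d * e']mulr1 -[_ - 1]mulr1 !mulrDl mulNr mul1r -!mulrA !locE.
by field; rewrite !distinct.
Qed.

Lemma loc_down g : loc (d' * e) g = loc (e * d'
  + (e * e' - e' * e) * (d * d' - d' * d) + 2 * (e * e' * e * d * d' * d)) g.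
Proof.
rewrite -[d' * e]mulr1 -[X in _ = loc X g]mulr1 mulr_natl mulr2n !mulrDl.
rewrite !mulNr !mulrBr !mulrBl -!mulrA !locE.
by field; rewrite !distinct.
Qed.

End TwoReflections.
End SkewOperators.

(** * The relations among divided differences *)

Section DividedDifferenceRelations.
Variables (k : fieldType) (n : nat).
Local Notation Rn := {mpoly k[n]}.
Local Notation F := {fraction Rn}.
Local Notation D := (ddiff_endo k (n := n)).
Local Notation E := (neg_ddiff_endo k (n := n)).

Definition fracX (j : 'I_n) : F := tofrac ('X_j : Rn).
(** The values of all the [s (u f)], which [ddiffE] relates to each other: this
    is the function [loc] of the computations above. *)
Definition twisted (f : Rn) (u : endo k n) (s : 'S_n) : F :=
  tofrac (msym s (u f)).

Lemma msymU (s : 'S_n) j : msym s 'X_j = 'X_(s j) :> Rn.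
Proof. by rewrite /msym mmapX mmap1U. Qed.

Lemma fracX_neq (i j : 'I_n) : i != j -> fracX i - fracX j != 0.
Proof.
move=> ij; rewrite /fracX -tofracB tofrac_eq0.
apply/eqP => /(congr1 (fun p : Rn => p@_(U_(i))%MM)).
rewrite mcoeffB !mcoeffX eqxx mcoeff0 eq_mnm1.
by rewrite eq_sym (negbTE ij) subr0 => /eqP; rewrite oner_eq0.
Qed.

Lemma twistedD f u v s : twisted f (u + v) s = twisted f u s + twisted f v s.
Proof. by rewrite /twisted endoDE (msymD s (u f)) tofracD. Qed.

Lemma twistedN f u s : twisted f (- u) s = - twisted f u s.
Proof. by rewrite /twisted endoNE (msymN s (u f)) tofracN. Qed.

Lemma twisted_eq (u v : endo k n) :
  (forall f, twisted f u 1%g = twisted f v 1%g) -> u = v.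
Proof.
move=> uv; apply: endoP => f; move: (uv f); rewrite /twisted !msym1m.
by move/eqP; rewrite tofrac_eq => /eqP.
Qed.

Local Notation fx i := (fun s : 'S_n => fracX (s (idx0 i))).
Local Notation fy i := (fun s : 'S_n => fracX (s (idx1 i))).

Lemma fx_neq_fy (i : 'I_n.-1) (s : 'S_n) : fx i s - fy i s != 0.
Proof. by apply: fracX_neq; rewrite (inj_eq perm_inj) idx01_neq. Qed.

Lemma tofrac_msym_ddiff i (s : 'S_n) (g : Rn) : tofrac (msym s (ddiff i g)) =
  (tofrac (msym s g) - tofrac (msym (simple_refl i * s)%g g))
  / (fx i s - fy i s).
Proof.
apply: (canRL (mulfK (fx_neq_fy i s))); rewrite /fracX -!msymU msymMm.
by rewrite -!tofracB -tofracM -!msymB -ddiffE msymM.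
Qed.

Lemma tofrac_msym_neg_ddiff i (s : 'S_n) (g : Rn) : tofrac (msym s (E i g)) =
  - (fx i s * ((fy i s * tofrac (msym s g)
                - fx i s * tofrac (msym (simple_refl i * s)%g g))
               / (fx i s - fy i s))).
Proof.
have -> : E i g = - ('X_(idx0 i) * ddiff i ('X_(idx1 i) * g)) by [].
rewrite msymN tofracN msymM tofracM msymU tofrac_msym_ddiff.
by rewrite !(msymM _ 'X_(idx1 i)) !tofracM !msymU permM tpermR.
Qed.

Lemma twisted_acts f i : acts_by_swap (twisted f) (mulg (simple_refl i))
  (fx i) (fy i) (D i) (E i).
Proof.
split=> u s; rewrite /twisted endoME; first exact: tofrac_msym_ddiff.
exact: tofrac_msym_neg_ddiff.
Qed.

Lemma simple_reflK i (s : 'S_n) : (simple_refl i * (simple_refl i * s))%g = s.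
Proof. by rewrite mulgA tperm2 mul1g. Qed.

Lemma simple_refl_l i (s : 'S_n) : fx i (simple_refl i * s)%g = fy i s.
Proof. by rewrite /= permM tpermL. Qed.

Lemma simple_refl_r i (s : 'S_n) : fy i (simple_refl i * s)%g = fx i s.
Proof. by rewrite /= permM tpermR. Qed.

Lemma ddiff_sq i : D i * D i = 0.
Proof.
apply: twisted_eq => f; rewrite (loc_sq (twisted_acts f i)) //.
- by rewrite /twisted endo0E msym0 tofrac0.
- exact: simple_reflK.
- exact: simple_refl_l.
- exact: simple_refl_r.
- exact: fx_neq_fy.
Qed.

Lemma neg_ddiff_sq i : E i * E i = 0.
Proof.
apply: twisted_eq => f; rewrite (loc_neg_sq (twisted_acts f i)) //.
- by rewrite /twisted endo0E msym0 tofrac0.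
- exact: simple_reflK.
- exact: simple_refl_l.
- exact: simple_refl_r.
- exact: fx_neq_fy.
Qed.

Lemma ddiff_neg_same i : 1 = D i * E i + E i * D i.
Proof.
apply: twisted_eq => f; rewrite (loc_same (twistedD f) (twisted_acts f i)) //.
- exact: simple_reflK.
- exact: simple_refl_l.
- exact: simple_refl_r.
- exact: fx_neq_fy.
Qed.

Section Far.
Variables i j : 'I_n.-1.
Hypothesis ij : far i j.

Fact far_neq : [/\ idx0 i != idx0 j, idx0 i != idx1 j, idx1 i != idx0 j
  & idx1 i != idx1 j].
Proof. by move: ij; rewrite /far -!val_eqE /=; split; lia. Qed.

Lemma far_fixes :
  ((simple_refl i (idx0 j) = idx0 j) * (simple_refl i (idx1 j) = idx1 j))
  * ((simple_refl j (idx0 i) = idx0 i) * (simple_refl j (idx1 i) = idx1 i)).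
Proof.
have [n00 n01 n10 n11] := far_neq.
by rewrite /simple_refl; do ?split; apply: tpermD => //; rewrite eq_sym.
Qed.

Lemma simple_refl_far (s : 'S_n) : (simple_refl i * (simple_refl j * s))%g =
  (simple_refl j * (simple_refl i * s))%g.
Proof.
rewrite !mulgA; congr (_ * s)%g; apply/permP => a; rewrite !permM.
have := far_fixes; rewrite /simple_refl => fixes.
case: (tpermP (idx0 i)) => [->|->|a0 a1].
- by rewrite !fixes tpermL.
- by rewrite !fixes tpermR.
- case: tpermP => [ea|ea|_ _]; rewrite ?fixes // tpermD //; rewrite eq_sym;
    exact/eqP.
Qed.

End Far.

(** The coefficients of [f] and [s_i(f)] in [∂_i⁻(f)] if [b] holds, and in
    [∂_i(f)] otherwise. *)
Definition skew_coefs (b : bool) i (s : 'S_n) : F * F :=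
  if b then (- (fx i s * (fy i s / (fx i s - fy i s))),
             fx i s * (fx i s / (fx i s - fy i s)))
  else ((fx i s - fy i s)^-1, - (fx i s - fy i s)^-1).

Definition signed_ddiff (b : bool) i := if b then E i else D i.

Lemma twisted_skew f b i u (s : 'S_n) : twisted f (signed_ddiff b i * u) s =
  (skew_coefs b i s).1 * twisted f u s
  + (skew_coefs b i s).2 * twisted f u (mulg (simple_refl i) s).
Proof.
case: b; rewrite ?(twisted_acts f i).1 ?(twisted_acts f i).2 /=.
  by move: (fx i s) (fy i s) (_^-1) (twisted f u _) (twisted f u _) => *; ring.
by move: (_^-1) (twisted f u _) (twisted f u _) => *; ring.
Qed.

Lemma skew_coefs_far b i j (s : 'S_n) : far i j ->
  skew_coefs b i (mulg (simple_refl j) s) = skew_coefs b i s.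
Proof. by move=> ij; rewrite /skew_coefs /= !permM !(far_fixes ij). Qed.

Lemma far_sym (i j : 'I_n.-1) : far i j = far j i.
Proof. by rewrite /far distnC. Qed.

Lemma signed_ddiff_far b b' i j : far i j ->
  signed_ddiff b i * signed_ddiff b' j = signed_ddiff b' j * signed_ddiff b i.
Proof.
move=> ij; have ji : far j i by rewrite far_sym.
apply: twisted_eq => f.
apply: (@loc_far _ _ _ (twisted f) _ _ _ _
  (fun s => (skew_coefs b i s).1) (fun s => (skew_coefs b i s).2)
  (fun s => (skew_coefs b' j s).1) (fun s => (skew_coefs b' j s).2) _
  (twisted_skew f b i) (twisted_skew f b' j)) => s.
- exact: simple_refl_far.
- by rewrite skew_coefs_far.
- by rewrite skew_coefs_far.
- by rewrite skew_coefs_far.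
- by rewrite skew_coefs_far.
Qed.

Section Adjacent.
Variables i j : 'I_n.-1.
Hypothesis ij : j = i.+1 :> nat.

Lemma adjacent_idx : idx0 j = idx1 i. Proof. exact/val_inj. Qed.

Fact adjacent_neq : (idx0 i != idx1 j) && (idx1 i != idx1 j).
Proof. by rewrite -!val_eqE /=; lia. Qed.

Fact adjacent_perm :
  (simple_refl i (idx0 i) = idx1 i) * (simple_refl i (idx1 i) = idx0 i)
  * (simple_refl i (idx1 j) = idx1 j) * (simple_refl j (idx0 i) = idx0 i)
  * (simple_refl j (idx1 i) = idx1 j) * (simple_refl j (idx1 j) = idx1 i).
Proof.
have /andP[n02 n12] := adjacent_neq; have n01 := idx01_neq i.
by rewrite /simple_refl adjacent_idx !tpermL !tpermR !tpermD // eq_sym.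
Qed.

Lemma simple_refl_braid (s : 'S_n) :
  (simple_refl j * (simple_refl i * (simple_refl j * s)) =
   simple_refl i * (simple_refl j * (simple_refl i * s)))%g.
Proof.
rewrite !mulgA; congr (_ * s)%g; apply/permP => a; rewrite !permM.
have fixes := adjacent_perm.
have [-> | a0] := eqVneq a (idx0 i); first by rewrite !fixes.
have [-> | a1] := eqVneq a (idx1 i); first by rewrite !fixes.
have [-> | a2] := eqVneq a (idx1 j); first by rewrite !fixes.
have fix_i : simple_refl i a = a by apply: tpermD; rewrite eq_sym.
have fix_j : simple_refl j a = a.
  by apply: tpermD; rewrite ?adjacent_idx eq_sym.
by rewrite !(fix_i, fix_j).
Qed.

Lemma simple_refl_r_below (s : 'S_n) : fy j (mulg (simple_refl i) s) = fy j s.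
Proof. by rewrite /= permM adjacent_perm. Qed.

Lemma simple_refl_l_above (s : 'S_n) : fx i (mulg (simple_refl j) s) = fx i s.
Proof. by rewrite /= permM adjacent_perm. Qed.

Lemma twisted_acts_above f :
  acts_by_swap (twisted f) (mulg (simple_refl j)) (fy i) (fy j) (D j) (E j).
Proof. by rewrite -adjacent_idx; apply: twisted_acts. Qed.

Lemma simple_refl_l_shared (s : 'S_n) : fy i (mulg (simple_refl j) s) = fy j s.
Proof. by rewrite /= permM adjacent_perm. Qed.

Lemma simple_refl_r_shared (s : 'S_n) : fy j (mulg (simple_refl j) s) = fy i s.
Proof. by rewrite /= permM adjacent_perm. Qed.

Let K := simple_reflK.

Lemma ddiff_braid : D i * D j * D i = D j * D i * D j.
Proof.
apply: twisted_eq => f.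
exact: (loc_braid (twisted_acts f i) (twisted_acts_above f) (K i) (K j)
  simple_refl_braid (simple_refl_l i) (simple_refl_r i) simple_refl_r_below
  simple_refl_l_above simple_refl_l_shared simple_refl_r_shared (fx_neq_fy i)).
Qed.

Lemma neg_ddiff_braid : E i * E j * E i = E j * E i * E j.
Proof.
apply: twisted_eq => f.
exact: (loc_neg_braid (twisted_acts f i) (twisted_acts_above f) (K i) (K j)
  simple_refl_braid (simple_refl_l i) (simple_refl_r i) simple_refl_r_below
  simple_refl_l_above simple_refl_l_shared simple_refl_r_shared (fx_neq_fy i)).
Qed.

Lemma ddiff_neg_up : D i * E j = (E i + E j) * D j + E i * D i - 1.
Proof.
apply: twisted_eq => f.
exact: (loc_up (twistedD f) (twistedN f)
  (twisted_acts f i) (twisted_acts_above f) (K i) (K j)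
  (simple_refl_l i) (simple_refl_r i) simple_refl_r_below
  simple_refl_l_above simple_refl_l_shared simple_refl_r_shared (fx_neq_fy i)).
Qed.

Lemma ddiff_neg_down : D j * E i = E i * D j
  + (E i * E j - E j * E i) * (D i * D j - D j * D i)
  + 2 * (E i * E j * E i * D i * D j * D i).
Proof.
apply: twisted_eq => f.
exact: (loc_down (twistedD f) (twistedN f)
  (twisted_acts f i) (twisted_acts_above f) (K i) (K j)
  simple_refl_braid (simple_refl_l i) (simple_refl_r i) simple_refl_r_below
  simple_refl_l_above simple_refl_l_shared simple_refl_r_shared (fx_neq_fy i)).
Qed.

End Adjacent.
End DividedDifferenceRelations.

(** * Divided differences and the constant polynomial *)

(** Extension by zero: the form of families expected by [nilCoxeter]. *)
Definition nat_family (m : nat) (B : nmodType) (g : 'I_m -> B) (i : nat) : B :=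
  if insub i is Some j then g j else 0.

Lemma nat_familyE m (B : nmodType) (g : 'I_m -> B) (i : 'I_m) :
  nat_family g i = g i.
Proof. by rewrite /nat_family valK. Qed.

Lemma nat_familyP m (B : nmodType) (g : 'I_m -> B) i (im : (i < m)%N) :
  nat_family g i = g (Ordinal im).
Proof. exact: (nat_familyE g (Ordinal im)). Qed.

Lemma nat_family_out m (B : nmodType) (g : 'I_m -> B) i :
  (m <= i)%N -> nat_family g i = 0.
Proof. by move=> mi; rewrite /nat_family insubF // ltnNge mi. Qed.

Section Vacuum.
Variables (k : fieldType) (n : nat).
Local Notation Rn := {mpoly k[n]}.
Local Notation D := (ddiff_endo k (n := n)).
Local Notation E := (neg_ddiff_endo k (n := n)).
Local Notation D' := (nat_family D).
Local Notation E' := (nat_family E).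

Lemma ddiff_symM i (p f : Rn) :
  msym (simple_refl i) p = p -> D i (p * f) = p * D i f.
Proof.
move=> sp; apply: (mulIf (subX_neq0 k i)).
by rewrite -mulrA !ddiffE msymM sp mulrBr.
Qed.

Lemma neg_ddiff_symM i (p f : Rn) :
  msym (simple_refl i) p = p -> E i (p * f) = p * E i f.
Proof.
have EE g : E i g = - ('X_(idx0 i) * D i ('X_(idx1 i) * g)) by [].
move=> sp; rewrite !EE (mulrCA 'X_(idx1 i)) (ddiff_symM _ sp).
by rewrite (mulrCA 'X_(idx0 i)) mulrN.
Qed.

Lemma ddiff1 i : D i 1 = 0.
Proof.
by apply: (mulIf (subX_neq0 k i)); rewrite ddiffE msym1 subrr mul0r.
Qed.

Lemma ddiffX i : D i 'X_(idx0 i) = 1.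
Proof.
apply: (mulIf (subX_neq0 k i)).
by rewrite ddiffE msymU tpermL mul1r.
Qed.

Lemma neg_ddiff1 i : E i 1 = 'X_(idx0 i).
Proof.
have -> : E i 1 = - ('X_(idx0 i) * D i ('X_(idx1 i) * 1)) by [].
suff -> : D i ('X_(idx1 i) * 1) = -1 by rewrite mulrN1 opprK.
apply: (mulIf (subX_neq0 k i)).
by rewrite mulr1 ddiffE msymU tpermR mulN1r opprB.
Qed.

Definition head_prod (m : nat) : Rn := \prod_(j < n | (j < m)%N) 'X_j.

Lemma head_prod0 : head_prod 0 = 1.
Proof. by rewrite /head_prod big_pred0. Qed.

Lemma head_prodS (i : 'I_n) : head_prod i.+1 = head_prod i * 'X_i.
Proof.
rewrite /head_prod (bigD1 i) //= mulrC; congr (_ * _).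
by apply: eq_bigl => j; rewrite ltnS ltn_neqAle andbC.
Qed.

Lemma head_prod_sym (i : 'I_n.-1) m : i.+1 != m ->
  msym (simple_refl i) (head_prod m) = head_prod m.
Proof.
move=> im; rewrite /head_prod rmorph_prod.
rewrite [RHS](reindex_inj (perm_inj (s := simple_refl i))) /=.
apply: eq_big => [j|j _]; last exact: msymU.
by rewrite /simple_refl; case: tpermP => [->|->|//] /=; lia.
Qed.

Lemma word_symM (g : 'I_n.-1 -> endo k n) (p f : Rn) w :
  (forall i : 'I_n.-1, (i : nat) \in w -> forall h, g i (p * h) = p * g i h) ->
  word (nat_family g) w (p * f) = p * word (nat_family g) w f.
Proof.
elim: w => [|i w IH] gp; first by rewrite word_nil.
rewrite word_cons !endoME IH; last first.
  by move=> j jw; apply: gp; rewrite inE jw orbT.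
have [Ni|iN] := leqP n.-1 i; first by rewrite nat_family_out // mulr0.
by rewrite (nat_familyE g (Ordinal iN)) gp // inE eqxx.
Qed.

Lemma neg_up_word1 m :
  (m <= n.-1)%N -> word E' (rev (iota 0 m)) 1 = head_prod m.
Proof.
elim: m => [|m IH] mn; first by rewrite word_nil head_prod0.
rewrite -addn1 iotaD rev_cat word_cons endoME add0n IH; last exact: ltnW.
pose i := Ordinal mn; rewrite (nat_familyE E i) addn1 -[head_prod m]mulr1.
rewrite neg_ddiff_symM ?neg_ddiff1 ?(head_prodS (idx0 i)) //.
by rewrite head_prod_sym //= gtn_eqF.
Qed.

Lemma up_word_head_prod m :
  (m <= n.-1)%N -> word D' (iota 0 m) (head_prod m) = 1.
Proof.
elim: m => [|m IH] mn; first by rewrite word_nil head_prod0.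
rewrite word_up endoME; pose i := Ordinal mn.
rewrite (nat_familyE D i) (head_prodS (idx0 i)).
rewrite ddiff_symM ?ddiffX ?mulr1 ?IH //.
  exact: ltnW.
by rewrite head_prod_sym //= gtn_eqF.
Qed.

Lemma longest_lt m i : i \in longest m -> (i < m)%N.
Proof.
elim: m => // m IH; rewrite longestS mem_cat mem_iota add0n => /orP[|/IH] //.
exact: ltnW.
Qed.

(** The word in the [∂_i⁻] produces the staircase monomial, one product
    [x_0 .. x_(m-1)] at a time, and the divided differences take it back to [1]:
    each such product is symmetric for the smaller words in between. *)
Lemma longest_pairing m : (m <= n.-1)%N ->
  word D' (longest m) (word E' (rev (longest m)) 1) = 1.
Proof.
elim: m => [|m IH] mn; first by rewrite !word_nil.
rewrite longestS rev_cat !word_cat !endoME neg_up_word1 // -[head_prod _]mulr1.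
rewrite word_symM; last first.
  move=> i; rewrite mem_rev => /longest_lt im h.
  by rewrite neg_ddiff_symM // head_prod_sym // ltn_eqF.
rewrite word_symM; last first.
  move=> i /longest_lt im h.
  by rewrite ddiff_symM // head_prod_sym // ltn_eqF.
by rewrite IH ?mulr1 ?up_word_head_prod //; exact: ltnW.
Qed.

End Vacuum.

(** * The presentation *)

Section Presentation.
Variables (k : fieldType) (I : choiceType) (A : algType k) (gen : I -> A).
Local Notation F := {free k[I]}.
Variable rel : F -> F -> Prop.
Local Notation P := (presented rel).
Hypothesis rel_gen : forall l r, rel l r -> free_eval gen l = free_eval gen r.

Definition presented_eval (x : P) : A := free_eval gen (pres_repr x).

Lemma ideal_gen_eval p : ideal_gen rel p -> free_eval gen p = 0.
Proof.
elim=> [|x y _ IHx _ IHy|a l r b lr]; first exact: rmorph0.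
  by rewrite rmorphD /= IHx IHy addr0.
by rewrite !rmorphM rmorphB /= (rel_gen lr) subrr mulr0 mul0r.
Qed.

Lemma presented_evalE p : presented_eval (pres rel p) = free_eval gen p.
Proof.
apply/eqP; rewrite -subr_eq0 -rmorphB; apply/eqP/ideal_gen_eval/pres_eq.
exact: presK.
Qed.

Fact presented_eval_is_additive : zmod_morphism presented_eval.
Proof.
by move=> x y; rewrite -[x]presK -[y]presK -rmorphB !presented_evalE rmorphB.
Qed.
Fact presented_eval_is_multiplicative : monoid_morphism presented_eval.
Proof.
split=> [|x y]; first by rewrite -(rmorph1 (pres rel)) presented_evalE rmorph1.
by rewrite -[x]presK -[y]presK -rmorphM !presented_evalE rmorphM.
Qed.
HB.instance Definition _ :=
  GRing.isZmodMorphism.Build P A presented_eval presented_eval_is_additive.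
HB.instance Definition _ :=
  GRing.isMonoidMorphism.Build P A presented_eval presented_eval_is_multiplicative.

Definition presented_eval_rmorphism : {rmorphism P -> A} := presented_eval.

(** The kernel of the induced morphism from the presented ring is a proper ideal,
    since [1] maps to [1]. *)
Lemma simple_presentation :
  (forall a, exists p, free_eval gen p = a) ->
  (forall K : P -> Prop, two_sided K -> ~ K 1 -> forall x, K x -> x = 0) ->
  defining_relations gen rel.
Proof.
move=> surj simple; split=> // p; split; last exact: ideal_gen_eval.
move=> p0; apply/pres_eq0.
apply: (simple (fun x => presented_eval x = 0)); last by rewrite presented_evalE.
  split; first split=> [|x y x0 y0|a x x0]; first exact: rmorph0.
  - by rewrite rmorphD /= x0 y0 addr0.
  - by rewrite rmorphM /= x0 mulr0.
  - by move=> a x x0; rewrite rmorphM /= x0 mul0r.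
by rewrite rmorph1; apply/eqP/oner_neq0.
Qed.

Definition pres_scalar (c : k) : P := pres rel c%:A.
Fact pres_scalar_is_additive : zmod_morphism pres_scalar.
Proof. by move=> c c'; rewrite /pres_scalar scalerBl rmorphB. Qed.
Fact pres_scalar_is_multiplicative : monoid_morphism pres_scalar.
Proof.
split=> [|c c']; first by rewrite /pres_scalar scale1r rmorph1.
by rewrite /pres_scalar -rmorphM -scalerAl mul1r scalerA.
Qed.
HB.instance Definition _ :=
  GRing.isZmodMorphism.Build k P pres_scalar pres_scalar_is_additive.
HB.instance Definition _ :=
  GRing.isMonoidMorphism.Build k P pres_scalar pres_scalar_is_multiplicative.

Lemma pres_scalar_central c x : pres_scalar c * x = x * pres_scalar c.
Proof.
rewrite -[x]presK /pres_scalar -!rmorphM; congr (pres rel _).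
exact: free_scalar_central.
Qed.

End Presentation.

Lemma nat_family_nilCoxeter m (B : pzRingType) (g : 'I_m -> B) :
  (forall i, g i * g i = 0) ->
  (forall i j : 'I_m, j = i.+1 :> nat -> g i * g j * g i = g j * g i * g j) ->
  (forall i j : 'I_m, (i.+1 < j)%N -> g i * g j = g j * g i) ->
  nilCoxeter (nat_family g) m.
Proof.
move=> sq braid comm; split=> [i|i|i|i j ij]; first exact: nat_family_out.
- have [im|mi] := ltnP i m; first by rewrite nat_familyP sq.
  by rewrite nat_family_out ?mul0r.
- have [im|mi] := ltnP i.+1 m; last first.
    by rewrite (nat_family_out g mi) !(mulr0, mul0r).
  by rewrite !nat_familyP ?(ltnW im) // => im'; apply: braid.
- have [jm|mj] := ltnP j m; last by rewrite (nat_family_out g mj) mulr0 mul0r.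
  have im : (i < m)%N by lia.
  by rewrite !nat_familyP comm.
Qed.

Lemma nat_family_relations m (B : pzRingType) (d e : 'I_m -> B) :
  (forall i, d i * d i = 0) ->
  (forall i j : 'I_m, j = i.+1 :> nat -> d i * d j * d i = d j * d i * d j) ->
  (forall i j : 'I_m, (1 < `|i - j|)%N -> d i * d j = d j * d i) ->
  (forall i, e i * e i = 0) ->
  (forall i j : 'I_m, j = i.+1 :> nat -> e i * e j * e i = e j * e i * e j) ->
  (forall i j : 'I_m, (1 < `|i - j|)%N -> e i * e j = e j * e i) ->
  (forall i j : 'I_m, (1 < `|i - j|)%N -> d i * e j = e j * d i) ->
  (forall i, 1 = d i * e i + e i * d i) ->
  (forall i j : 'I_m, j = i.+1 :> nat ->
    d i * e j = (e i + e j) * d j + e i * d i - 1) ->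
  (forall i j : 'I_m, j = i.+1 :> nat ->
    d j * e i = e i * d j + (e i * e j - e j * e i) * (d i * d j - d j * d i)
      + 2 * (e i * e j * e i * d i * d j * d i)) ->
  double_nilCoxeter_relations m (nat_family d) (nat_family e).
Proof.
move=> dd dbraid dcomm ee ebraid ecomm de same up down.
split.
- by apply: nat_family_nilCoxeter => // i j ij; apply: dcomm; lia.
- by apply: nat_family_nilCoxeter => // i j ij; apply: ecomm; lia.
- move=> i j ij.
  have [im|mi] := ltnP i m; last by rewrite nat_family_out // mulr0 mul0r.
  have [jm|mj] := ltnP j m; last by rewrite (nat_family_out e mj) mulr0 mul0r.
  by rewrite !nat_familyP; apply: de => /=; lia.
- by move=> i im; rewrite !nat_familyP.
- by move=> i im; have im' := ltnW im; rewrite !nat_familyP; apply: up.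
- by move=> i im; have im' := ltnW im; rewrite !nat_familyP; apply: down.
Qed.

(* The relations are transported through an abstract morphism, in order to pass
   both from operators to the free algebra and from the free algebra to the
   presented ring. *)
Section MorphismRelations.
Variables (R S : pzRingType) (f : {rmorphism R -> S}).
Variables (d d' e e' : R) (D D' E E' : S).
Hypotheses (fd : f d = D) (fd' : f d' = D') (fe : f e = E) (fe' : f e' = E').

Let fE := (rmorphM, rmorphD, rmorphN, rmorph1, rmorph0, rmorph_nat,
  fd, fd', fe, fe').

Lemma rmorph_sq : f (d * d) = f 0 <-> D * D = 0.
Proof. by rewrite !fE. Qed.

Lemma rmorph_braid :
  f (d * d' * d) = f (d' * d * d') <-> D * D' * D = D' * D * D'.
Proof. by rewrite !fE. Qed.

Lemma rmorph_comm : f (d * d') = f (d' * d) <-> D * D' = D' * D.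
Proof. by rewrite !fE. Qed.

Lemma rmorph_same : f 1 = f (d * d' + d' * d) <-> 1 = D * D' + D' * D.
Proof. by rewrite !fE. Qed.

Lemma rmorph_up : f (d * e') = f ((e + e') * d' + e * d - 1) <->
  D * E' = (E + E') * D' + E * D - 1.
Proof. by rewrite !fE. Qed.

Lemma rmorph_down :
  f (d' * e) = f (e * d' + (e * e' - e' * e) * (d * d' - d' * d)
    + 2 * (e * e' * e * d * d' * d)) <->
  D' * E = E * D' + (E * E' - E' * E) * (D * D' - D' * D)
    + 2 * (E * E' * E * D * D' * D).
Proof. by rewrite !fE. Qed.

End MorphismRelations.

Section DoubleNilCoxeterPresentation.
Variables (k : fieldType) (n : nat).
Local Notation F := {free k[dnc_idx n]}.
Local Notation rel := (@dnc_rel k n).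
Local Notation P := (presented rel).
Local Notation D := (ddiff_endo k (n := n)).
Local Notation E := (neg_ddiff_endo k (n := n)).

Lemma dnc_gen_rel l r : rel l r ->
  free_eval (@dnc_gen k n) l = free_eval (@dnc_gen k n) r.
Proof.
move=> lr; apply/val_inj; rewrite /= !subalgebra_eval.
pose f : {rmorphism F -> endo k n} := free_eval (@dnc_operator k n).
have fX x : f (fvar k x) = dnc_operator k x by apply: free_eval_fvar.
suff : f l = f r by [].
case: lr => {l r} [i|i j ij|i j ij|i|i j ij|i j ij|i j ij|i|i j ij|i j ij].
- apply/(rmorph_sq (fX (inl i))); exact: ddiff_sq.
- apply/(rmorph_braid (fX (inl i)) (fX (inl j))); exact: ddiff_braid.
- apply/(rmorph_comm (fX (inl i)) (fX (inl j))).
  exact: (signed_ddiff_far k false false ij).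
- apply/(rmorph_sq (fX (inr i))); exact: neg_ddiff_sq.
- apply/(rmorph_braid (fX (inr i)) (fX (inr j))); exact: neg_ddiff_braid.
- apply/(rmorph_comm (fX (inr i)) (fX (inr j))).
  exact: (signed_ddiff_far k true true ij).
- apply/(rmorph_comm (fX (inl i)) (fX (inr j))).
  exact: (signed_ddiff_far k false true ij).
- apply/(rmorph_same (fX (inl i)) (fX (inr i))); exact: ddiff_neg_same.
- apply/(rmorph_up (fX (inl i)) (fX (inl j)) (fX (inr i)) (fX (inr j))).
  exact: ddiff_neg_up.
- apply/(rmorph_down (fX (inl i)) (fX (inl j)) (fX (inr i)) (fX (inr j))).
  exact: ddiff_neg_down.
Qed.

Definition presented_d (i : 'I_n.-1) : P :=
  pres rel (fvar k (inl i : dnc_idx n)).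
Definition presented_e (i : 'I_n.-1) : P :=
  pres rel (fvar k (inr i : dnc_idx n)).
Local Notation d := (nat_family presented_d).
Local Notation e := (nat_family presented_e).

Lemma presented_relations : double_nilCoxeter_relations n.-1 d e.
Proof.
pose f : {rmorphism F -> P} := pres rel.
have fd i : f (fvar k (inl i)) = presented_d i by [].
have fe i : f (fvar k (inr i)) = presented_e i by [].
have frel l r : rel l r -> f l = f r by apply: pres_rel.
apply: nat_family_relations =>
  [i|i j ij|i j ij|i|i j ij|i j ij|i j ij|i|i j ij|i j ij].
- exact: (proj1 (rmorph_sq (fd i)) (frel _ _ (dnc_sq _ i))).
- exact: (proj1 (rmorph_braid (fd i) (fd j)) (frel _ _ (dnc_braid _ ij))).
- exact: (proj1 (rmorph_comm (fd i) (fd j)) (frel _ _ (dnc_comm _ ij))).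
- exact: (proj1 (rmorph_sq (fe i)) (frel _ _ (dnc_neg_sq _ i))).
- exact: (proj1 (rmorph_braid (fe i) (fe j)) (frel _ _ (dnc_neg_braid _ ij))).
- exact: (proj1 (rmorph_comm (fe i) (fe j)) (frel _ _ (dnc_neg_comm _ ij))).
- exact: (proj1 (rmorph_comm (fd i) (fe j)) (frel _ _ (dnc_mixed_comm _ ij))).
- exact: (proj1 (rmorph_same (fd i) (fe i)) (frel _ _ (dnc_mixed_same _ i))).
- exact: (proj1 (rmorph_up (fd i) (fd j) (fe i) (fe j))
    (frel _ _ (dnc_mixed_up _ ij))).
- exact: (proj1 (rmorph_down (fd i) (fd j) (fe i) (fe j))
    (frel _ _ (dnc_mixed_down _ ij))).
Qed.

Lemma presented_generated (S : P -> Prop) :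
  (forall c, S (pres_scalar rel c)) -> (forall x y, S x -> S y -> S (x + y)) ->
  (forall i x, S x -> S (d i * x)) -> (forall i x, S x -> S (e i * x)) ->
  forall x, S x.
Proof.
move=> S1 SD Sd Se x; rewrite -[x]presK.
elim/free_ind: (pres_repr x) => [//|p q Sp Sq|[i|i] p Sp].
- by rewrite rmorphD; apply: SD.
- by have := Sd i _ Sp; rewrite nat_familyE rmorphM.
- by have := Se i _ Sp; rewrite nat_familyE rmorphM.
Qed.

Definition presented_act (x : P) : endo k n :=
  subalgebra_val (presented_eval (@dnc_gen k n) x).

Local Notation eval_rmorphism := (presented_eval_rmorphism dnc_gen_rel).

Lemma presented_actD x y :
  presented_act (x + y) = presented_act x + presented_act y.
Proof. by rewrite /presented_act (rmorphD eval_rmorphism). Qed.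

Lemma presented_actM x y :
  presented_act (x * y) = presented_act x * presented_act y.
Proof. by rewrite /presented_act (rmorphM eval_rmorphism). Qed.

Lemma act_nat_family (g : 'I_n.-1 -> P) (u : 'I_n.-1 -> endo k n) i :
  (forall i, presented_act (g i) = u i) ->
  presented_act (nat_family g i) = nat_family u i.
Proof.
move=> gu; have [im|mi] := ltnP i n.-1; first by rewrite !nat_familyP.
by rewrite !nat_family_out // /presented_act (rmorph0 eval_rmorphism).
Qed.

Lemma act_word (g : 'I_n.-1 -> P) (u : 'I_n.-1 -> endo k n) w :
  (forall i, presented_act (g i) = u i) ->
  presented_act (word (nat_family g) w) = word (nat_family u) w.
Proof.
move=> gu; elim: w => [|i w IH].
  by rewrite !word_nil /presented_act (rmorph1 eval_rmorphism).
by rewrite !word_cons presented_actM IH (act_nat_family _ gu).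
Qed.

Lemma act_presented_d i : presented_act (presented_d i) = D i.
Proof.
rewrite /presented_act (presented_evalE dnc_gen_rel).
by rewrite subalgebra_eval free_eval_fvar.
Qed.

Lemma act_presented_e i : presented_act (presented_e i) = E i.
Proof.
rewrite /presented_act (presented_evalE dnc_gen_rel).
by rewrite subalgebra_eval free_eval_fvar.
Qed.

(** Divided differences kill constants. *)
Lemma left_ideal_act1 x : left_ideal d x -> presented_act x 1 = 0.
Proof.
elim=> [a i|y z _ IHy _ IHz]; last first.
  by rewrite presented_actD endoDE IHy IHz addr0.
rewrite presented_actM endoME (act_nat_family _ act_presented_d).
have [im|mi] := ltnP i n.-1; last by rewrite nat_family_out // linear0.
by rewrite nat_familyP ddiff1 linear0.
Qed.

Lemma presented_top_nondegenerate : ~ left_ideal d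
  (word d (longest n.-1) * word e (rev (longest n.-1))).
Proof.
move/left_ideal_act1; rewrite presented_actM.
rewrite (act_word _ act_presented_d) (act_word _ act_presented_e).
by rewrite endoME longest_pairing // => /eqP; rewrite oner_eq0.
Qed.

End DoubleNilCoxeterPresentation.

Theorem proposition2p16 (k : fieldType) (n : nat) :
  defining_relations (@dnc_gen k n) (@dnc_rel k n).
Proof.
apply: simple_presentation; first exact: dnc_gen_rel.
  move=> a; have [p pa] := gen_subalg_eval (subalgebra_valP a).
  by exists p; apply: val_inj; rewrite /= subalgebra_eval.
apply: (double_nilCoxeter_simple (scal := pres_scalar _)
  (@presented_relations k n)).
- exact: pres_scalar_central.
- exact: presented_generated.
- exact: presented_top_nondegenerate.
Qed.
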